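(* Let $n\ge2$, let $\Omega\subset\mathbb{R}^n$ be a bounded domain, let $0<T<\infty$ and $\Omega_T=\Omega\times(0,T)$. Let $H$ satisfy Conditions A, B and C with $k>1$. Let $u:\Omega_T\to[0,\infty)$ be lower semicontinuous and a viscosity super-solution, i.e. $$H(Du,D^2u)-u^{k-1}u_t\le0\quad\text{in }\Omega_T.$$ Set $m=\inf_{\Omega_T}u$. The following hold. (a) Suppose that $m>0$. If $u(p,\tau)>m$ for some $(p,\tau)\in\Omega_T$, then there is a $\rho>0$ such that $u>m$ in the cylinder $B_\rho(p)\times[\tau,T)$. As a consequence, if $u(p,\tau)=m$ for some $(p,\tau)\in\Omega_T$, then $u(p,s)=m$ for all $0<s<\tau$. (b) Suppose that $m=0$, that $u\in C(\Omega_T)$, and that $(p,\tau)\in\Omega_T$ is such that $u(p,\tau)=0$. Then there is a sequence of points $\{(x_\ell,t_\ell)\}_{\ell=1}^\infty\subset\Omega_T$ such that $t_\ell<\tau$ and $u(x_\ell,t_\ell)=0$ for every $\ell$, and $(x_\ell,t_\ell)\to(p,\tau)$.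
   Context: $S^n$ is the set of real symmetric $n\times n$ matrices, $I$ the identity matrix, $O$ the zero matrix, and $X\le Y$ means $Y-X$ is positive semidefinite. $B_\rho(x)$ is the ball in $\mathbb{R}^n$ with center $x$ and radius $\rho$. Condition A: $H:\mathbb{R}^n\times S^n\to\mathbb{R}$ is continuous, $H(p,O)=0$ for all $p\in\mathbb{R}^n$, and $H(p,X)\le H(p,Y)$ for all $p\in\mathbb{R}^n$ and all $X\le Y$ in $S^n$. Condition B: there is a constant $k_1\ge0$ such that for all $(p,X)\in\mathbb{R}^n\times S^n$: $H(\theta p,X)=|\theta|^{k_1}H(p,X)$ for all $\theta\in\mathbb{R}$, and $H(p,\theta X)=\theta H(p,X)$ for all $\theta>0$. Set $k=k_1+1$. It is not assumed that $H$ is odd in $X$. Condition C: for $\Lambda\in\mathbb{R}$ set $$m(\Lambda)=\min\Big(\min_{|e|=1}H(e,I-\Lambda e\otimes e),\,-\max_{|e|=1}H(e,\Lambda e\otimes e-I)\Big),$$ $$M(\Lambda)=\max\Big(\max_{|e|=1}H(e,I-\Lambda e\otimes e),\,-\min_{|e|=1}H(e,\Lambda e\otimes e-I)\Big).$$ Then $m(\Lambda)>0$ for all $\Lambda<1$, and there is $\Lambda_1\ge1$ such that $M(\Lambda)<0$ for all $\Lambda\ge\Lambda_1$. Viscosity super-solution: whenever $\psi$ is $C^2$ in $x$ and $C^1$ in $t$ and $u-\psi$ has a minimum at $(y,s)\in\Omega_T$, then $H(D\psi,D^2\psi)(y,s)-u(y,s)^{k-1}\psi_t(y,s)\le0$.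 *)

(* Defs.v *)
From HB Require Import structures.
From mathcomp Require Import all_boot all_order all_algebra.
From mathcomp Require Import all_classical all_reals all_analysis.
Set Implicit Arguments.
Unset Strict Implicit.
Unset Printing Implicit Defensive.
Import Order.TTheory GRing.Theory Num.Theory numFieldNormedType.Exports.
Local Open Scope classical_set_scope.
Local Open Scope ring_scope.

(* The library norm on 'rV[R]_n is the sup norm, hence the following. *)
Definition enorm (R : realType) (n : nat) (x : 'rV[R]_n) : R :=
  Num.sqrt (\sum_(i < n) x ord0 i ^+ 2).

Definition eball (R : realType) (n : nat) (x : 'rV[R]_n) (rho : R) :
    set 'rV[R]_n :=
  [set y | enorm (y - x) < rho].

Definition domain (R : realType) (n : nat) (U : set 'rV[R]_n) : Prop :=
  [/\ U !=set0, open U & connected U].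

Definition cylinder (R : realType) (n : nat) (Omega : set 'rV[R]_n) (T : R) :
    set ('rV[R]_n * R) :=
  Omega `*` [set t | 0 < t < T].

Definition sym (R : realType) (n : nat) : set 'M[R]_n := [set X | X^T = X].

Definition psd (R : realType) (n : nat) (X : 'M[R]_n) : Prop :=
  sym X /\ forall v : 'rV[R]_n, 0 <= (v *m X *m v^T) ord0 ord0.

Definition mxle (R : realType) (n : nat) (X Y : 'M[R]_n) : Prop := psd (Y - X).

Definition tensor (R : realType) (n : nat) (e : 'rV[R]_n) : 'M[R]_n :=
  e^T *m e.

(* H lives on R^n x S^n: it is a total function of a square matrix, and only
   its values at symmetric matrices are ever constrained or used. *)
Section Conditions.
Context (R : realType) (n : nat) (H : 'rV[R]_n -> 'M[R]_n -> R).

Definition conditionA : Prop :=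
  [/\ {within [set pX : 'rV[R]_n * 'M[R]_n | sym pX.2],
         continuous (fun pX => H pX.1 pX.2)},
      (forall p, H p 0 = 0) &
      (forall p X Y, sym X -> sym Y -> mxle X Y -> H p X <= H p Y)].

Definition conditionB (k1 : R) : Prop :=
  0 <= k1 /\
  forall p X, sym X ->
    (forall theta : R, H (theta *: p) X = `|theta| `^ k1 * H p X) /\
    (forall theta : R, 0 < theta -> H p (theta *: X) = theta * H p X).

Definition usphere : set 'rV[R]_n := [set e | enorm e = 1].

(* inf and sup over the unit sphere are the min and max of the definition:
   the sphere is compact and, under conditionA, H is continuous. *)
Definition mC (Lambda : R) : R :=
  Num.min (inf [set H e (1%:M - Lambda *: tensor e) | e in usphere])
          (- sup [set H e (Lambda *: tensor e - 1%:M) | e in usphere]).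

Definition MC (Lambda : R) : R :=
  Num.max (sup [set H e (1%:M - Lambda *: tensor e) | e in usphere])
          (- inf [set H e (Lambda *: tensor e - 1%:M) | e in usphere]).

Definition conditionC : Prop :=
  (forall Lambda : R, Lambda < 1 -> 0 < mC Lambda) /\
  exists Lambda1 : R,
    1 <= Lambda1 /\ forall Lambda : R, Lambda1 <= Lambda -> MC Lambda < 0.

End Conditions.

Section Viscosity.
Context (R : realType) (n : nat).
Implicit Types (psi u : 'rV[R]_n * R -> R) (z : 'rV[R]_n * R).

Definition dx (i : 'I_n) psi z : R :=
  'D_(delta_mx ord0 i) (fun y : 'rV[R]_n => psi (y, z.2)) z.1.

Definition dt psi z : R := derive1 (fun s : R => psi (z.1, s)) z.2.

Definition gradx psi z : 'rV[R]_n := \row_i dx i psi z.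

Definition hessx psi z : 'M[R]_n := \matrix_(i, j) dx i (dx j psi) z.

Definition derivablex (i : 'I_n) psi z : Prop :=
  derivable (fun y : 'rV[R]_n => psi (y, z.2)) z.1 (delta_mx ord0 i).

Definition derivablet psi z : Prop :=
  derivable (fun s : R => psi (z.1, s)) z.2 1.

(* psi is C^2 in x and C^1 in t on A: the derivatives involved exist on A and
   are jointly continuous there. *)
Definition C2x1t (A : set ('rV[R]_n * R)) psi : Prop :=
  [/\ {within A, continuous psi},
      (forall i, (forall z, A z -> derivablex i psi z) /\
         {within A, continuous (dx i psi)}),
      (forall i j, (forall z, A z -> derivablex i (dx j psi) z) /\
         {within A, continuous (dx i (dx j psi))}) &
      (forall z, A z -> derivablet psi z) /\ {within A, continuous (dt psi)}].

Definition min_on (A : set ('rV[R]_n * R)) (f : 'rV[R]_n * R -> R) z : Prop :=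
  A z /\ forall w, A w -> f z <= f w.

Definition viscosity_supersolution (H : 'rV[R]_n -> 'M[R]_n -> R) (k : R)
    (A : set ('rV[R]_n * R)) u : Prop :=
  forall psi z, C2x1t A psi -> min_on A (fun w => u w - psi w) z ->
    H (gradx psi z) (hessx psi z) - u z `^ (k - 1) * dt psi z <= 0.

Definition lsc_on (A : set ('rV[R]_n * R)) u : Prop :=
  lower_semicontinuous ((fun z => (u z)%:E) : subspace A -> \bar R).

End Viscosity.

(* Main.v *)
Require Import Defs.
From HB Require Import structures.
From mathcomp Require Import all_boot all_order all_algebra.
From mathcomp Require Import all_classical all_reals all_analysis.
From mathcomp Require Import ring lra.
Import Order.TTheory GRing.Theory Num.Theory numFieldNormedType.Exports.
Local Open Scope classical_set_scope.
Local Open Scope ring_scope.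

(** With v = psi - m, both parts compare u from below with the barriers
    psi(x,t) = m + e (rho^2 - |x-p|^2)_+^N g(t), where g(t) = exp(-lam t) on
    [c1, c2] and g is cut off before c1, when u is known to be large, and after
    c2.  Where |x-p|^2 >= rho^2/2 the Hessian of psi is a positive multiple of
    Lambda (e (x) e) - I with Lambda large, so Condition C gives
    H(D psi, D^2 psi) >= 0; on the rest of the ball, homogeneity gives
    H(D psi, D^2 psi) >= - C v^k with C independent of e and g.  On the other
    side - psi_t >= lam v, so if lam > C then psi cannot touch u from below
    (up to an additive constant) at a point where u >= v > 0.
    In (a) the choice e <= m makes u >= m >= v automatic, and the minimum of
    u - psi may be negative.  In (b), if u > 0 at all times before tau near p,
    contact with u = v is forced by taking the largest e for which psi <= u;
    the resulting lower bound for u(p, c2) does not degenerate as c2 tends to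
    tau, which contradicts u(p, tau) = 0. *)

(** * Minima of lower semicontinuous functions *)

(** Without a minimiser, every point of [K] has a relative neighbourhood on which [f] exceeds a
    level strictly above the infimum. Compactness yields one such level valid on all of [K], which
    contradicts the definition of the infimum. *)
Lemma lsc_compact_argmin {X : topologicalType} {R : realType} (f : X -> R)
    (K : set X) (M : R) :
  K !=set0 -> compact K -> (forall x, K x -> M <= f x) ->
  (forall x a, K x -> a < f x -> \forall y \near x, K y -> a < f y) ->
  exists2 z, K z & forall x, K x -> f z <= f x.
Proof.
move=> K0 cK fM lscf; apply: contrapT => nomin.
have infK : has_inf (f @` K).
  split; first by case: K0 => x Kx; exists (f x), x.
  by exists M => _ [x Kx <-]; exact: fM.
have lower x : K x -> exists2 y, K y & f y < f x.
  move=> Kx; apply: contrapT => nox; apply: nomin; exists x => // y Ky.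
  by rewrite leNgt; apply/negP => yx; apply: nox; exists y.
have inf_le y : K y -> inf (f @` K) <= f y.
  by move=> Ky; apply: ge_inf; [exact: infK.2|exists y].
have /compact_near_coveringP/near_covering_withinP cov := cK.
have : \forall i \near (inf (f @` K))^'+, K `<=` (fun x => i < f x).
  (* The second point [y'] lies below [y], so [f y] is strictly above the infimum and leaves room
     for levels [i] between the two. *)
  apply: cov => x Kx; have [y Ky yx] := lower _ Kx;
    have [y' Ky' yy'] := lower _ Ky.
  have fyi : inf (f @` K) < f y by rewrite (le_lt_trans (inf_le _ Ky')).
  exists ([set x' | K x' -> f y < f x'], [set i | i < f y]).
    by split; [exact: lscf|exact: nbhs_right_lt].
  by case=> x' i [/= yx' iy] Kx'; exact: lt_trans iy (yx' Kx').
move=> cov'.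
have [i [ii Ki]] : exists i, inf (f @` K) < i /\ K `<=` (fun x => i < f x).
  near (inf (f @` K))^'+ => i; exists i.
  split; first by near: i; exact: nbhs_right_gt.
  by near: i.
have [_ [x Kx <-]] := inf_adherent
  (eps := i - inf (f @` K)) ltac:(by rewrite subr_gt0) infK.
by rewrite addrC subrK ltNge (ltW (Ki _ Kx)).
Unshelve. all: by end_near. Qed.

(** * Directional derivatives and powers of the positive part *)

(** Turns a directional derivative into a derivative at 0 in one real variable, where the
    one-variable chain rule applies. *)
Lemma is_derive_line {R : realType} {V W : normedModType R} (f : V -> W)
    (x v : V) (d : W) :
  is_derive x v f d <-> is_derive (0 : R) 1 (fun h => f (h *: v + x)) d.
Proof.
have E : (fun h : R => h^-1 *: (((fun h => f (h *: v + x)) \o shift 0) (h *: 1)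
      - f (0 *: v + x))) = (fun h => h^-1 *: ((f \o shift x) (h *: v) - f x)).
  by apply/funext => h /=; rewrite addr0 scale0r add0r [h%:A]mulr1.
by split=> -[D e]; split; rewrite /derivable /derive ?E -?E //;
  move: D e; rewrite /derivable /derive E.
Qed.

Lemma is_derive_comp_dir {R : realType} {V : normedModType R} (f : R -> R)
    (w : V -> R) (x v : V) (a b : R) :
  is_derive (w x) 1 f a -> is_derive x v w b -> is_derive x v (f \o w) (a * b).
Proof.
move=> df /is_derive_line dw; apply/is_derive_line.
have := @is_derive1_comp R f (fun h => w (h *: v + x)) 0 a b.
by apply => //; rewrite scale0r add0r.
Qed.

(** The truncated power s_+^N. For N = 0 it is the constant 1, so vanishing on s <= 0 is available
    only for positive exponents. *)
Definition pos_pow {R : realType} (N : nat) (s : R) : R := Num.max 0 s ^+ N.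

Lemma continuous_pos_pow {R : realType} N : continuous (@pos_pow R N).
Proof.
move=> s; rewrite -[pos_pow N]/((fun t : R => t ^+ N) \o (Num.max 0)).
apply: continuous_comp; last exact: exprn_continuous.
by apply: continuous_max; [exact: cst_continuous|exact: cvg_id].
Qed.

Lemma pos_pow_ge0 {R : realType} N (s : R) : 0 <= pos_pow N s.
Proof. by rewrite exprn_ge0// le_max lexx. Qed.

Lemma pos_powE {R : realType} N (s : R) : 0 <= s -> pos_pow N s = s ^+ N.
Proof. by move=> s0; rewrite /pos_pow (max_idPr _). Qed.

Lemma pos_pow0 {R : realType} N (s : R) : s <= 0 -> pos_pow N.+1 s = 0.
Proof. by move=> s0; rewrite /pos_pow (max_idPl _)// expr0n. Qed.

Lemma pos_powS {R : realType} N (s : R) : pos_pow N.+2 s = s * pos_pow N.+1 s.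
Proof.
have [s0|/ltW s0] := leP 0 s; first by rewrite !pos_powE// exprS.
by rewrite !pos_pow0// mulr0.
Qed.

(** Only s = 0 is delicate: there the difference quotient is [pos_pow N.+1 h], which tends to 0
    because the exponent is still positive. *)
Lemma is_derive_pos_pow {R : realType} N (s : R) :
  is_derive s 1 (pos_pow N.+2) (N.+2%:R * pos_pow N.+1 s).
Proof.
have [s0|s0|->] := ltgtP s 0.
- rewrite pos_pow0 ?ltW// mulr0; apply: (@near_eq_is_derive _ _ _ (cst 0)).
  by apply: filterS (lt_nbhsl s0) => t /ltW t0 /=; rewrite pos_pow0.
- rewrite pos_powE ?ltW//; apply: (@near_eq_is_derive _ _ _ ((@id R) ^+ N.+2)).
    by apply: filterS (lt_nbhsr s0) => t /ltW t0 /=;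
      rewrite pos_powE// exprfctE.
  by apply: is_derive_eq; rewrite /= [LHS]mulr1.
- rewrite pos_pow0// mulr0.
  have D : h^-1 *: ((pos_pow N.+2 \o shift 0) (h *: (1:R)) - pos_pow N.+2 0)
    @[h --> (0:R)^'] --> (0:R).
    apply: (@cvg_trans _ (pos_pow N.+1 h @[h --> (0:R)^'])).
      apply: near_eq_cvg; near=> h => /=.
      rewrite [pos_pow _ 0]pos_pow0// subr0 addr0 [h%:A]mulr1 pos_powS
        /GRing.scale /=.
      by rewrite mulrA mulVf ?mul1r//; near: h; exact: nbhs_dnbhs_neq.
    have : pos_pow N.+1 h @[h --> (0:R)^'] --> pos_pow N.+1 (0:R).
      by apply: cvg_within_filter; exact: continuous_pos_pow.
    by rewrite pos_pow0.
  by split; [apply/cvg_ex; exists 0|exact: cvg_lim D].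
Unshelve. all: by end_near. Qed.

(** * Test functions with separated variables *)

Section Separated.
Context {R : realType} {n : nat}.
Variables (f : 'rV[R]_n -> R) (df : 'I_n -> 'rV[R]_n -> R)
  (d2f : 'I_n -> 'I_n -> 'rV[R]_n -> R) (g dg : R -> R) (m : R).
Hypotheses
  (fD : forall (x : 'rV[R]_n) i, is_derive x (delta_mx ord0 i) f (df i x))
  (dfD : forall (x : 'rV[R]_n) i j,
    is_derive x (delta_mx ord0 i) (df j) (d2f i j x))
  (gD : forall t : R, is_derive t 1 g (dg t)).
Hypotheses (fC : continuous f) (dfC : forall i, continuous (df i))
  (d2fC : forall i j, continuous (d2f i j)) (gC : continuous g)
  (dgC : continuous dg).

Let psi (z : 'rV[R]_n * R) := m + f z.1 * g z.2.

Let continuous_sep (a : 'rV[R]_n -> R) (b : R -> R) :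
  continuous a -> continuous b -> continuous (fun z => a z.1 * b z.2).
Proof.
move=> aC bC z; apply: (@continuousM _ _ (a \o fst) (b \o snd)).
  by apply: continuous_comp; [exact: cvg_fst|exact: aC].
by apply: continuous_comp; [exact: cvg_snd|exact: bC].
Qed.

Let is_derive_affine {V : normedModType R} (a : V -> R) (c b : R) x v d :
  is_derive x v a d -> is_derive x v (fun y => c + a y * b) (d * b).
Proof.
move=> ad.
suff : is_derive x v (cst c + a * cst b) (d * b) by [].
have := is_deriveD (is_derive_cst c x v) (is_deriveM ad (is_derive_cst b x v)).
by rewrite scaler0 !add0r [_ *: d]mulrC.
Qed.

Let psi_is_derive i (z : 'rV[R]_n * R) :
  is_derive z.1 (delta_mx ord0 i) (fun y => psi (y, z.2)) (df i z.1 * g z.2).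
Proof. exact: (is_derive_affine _ m (g z.2) _ _ _ (fD z.1 i)). Qed.

Let dx_psi i : dx i psi = (fun z => df i z.1 * g z.2).
Proof. by apply/funext => z; have [_ e] := psi_is_derive i z; exact: e. Qed.

Let dx_psi_is_derive i j (z : 'rV[R]_n * R) :
  is_derive z.1 (delta_mx ord0 i) (fun y => dx j psi (y, z.2))
    (d2f i j z.1 * g z.2).
Proof.
rewrite dx_psi /=.
have := is_derive_affine _ 0 (g z.2) _ _ _ (dfD z.1 i j).
by under eq_fun do rewrite add0r.
Qed.

Let dxx_psi i j : dx i (dx j psi) = (fun z => d2f i j z.1 * g z.2).
Proof. by apply/funext => z; have [_ e] := dx_psi_is_derive i j z;
  exact: e. Qed.

Let psi_is_derivet (z : 'rV[R]_n * R) :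
  is_derive z.2 1 (fun t => psi (z.1, t)) (f z.1 * dg z.2).
Proof.
rewrite mulrC; have := is_derive_affine _ m (f z.1) _ _ _ (gD z.2).
by under eq_fun do rewrite mulrC.
Qed.

Lemma gradx_sep z : gradx psi z = g z.2 *: \row_i df i z.1.
Proof. by apply/rowP => i; rewrite !mxE dx_psi mulrC. Qed.

Lemma hessx_sep z : hessx psi z = g z.2 *: \matrix_(i, j) d2f i j z.1.
Proof. by apply/matrixP => i j; rewrite !mxE dxx_psi mulrC. Qed.

Lemma dt_sep z : dt psi z = f z.1 * dg z.2.
Proof. by rewrite /dt derive1E; have [_ e] := psi_is_derivet z; exact: e. Qed.

Lemma C2x1t_sep A : C2x1t A psi.
Proof.
split.
- apply: continuous_subspaceT => z; apply: (@continuousD _ _ _ (cst m)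
    (fun z => f z.1 * g z.2)); first exact: cst_continuous.
  exact: continuous_sep.
- move=> i; split=> [z _|].
    have [D _] := psi_is_derive i z; exact: D.
  by rewrite dx_psi; apply: continuous_subspaceT; exact: continuous_sep.
- move=> i j; split=> [z _|].
    have [D _] := dx_psi_is_derive i j z; exact: D.
  by rewrite dxx_psi; apply: continuous_subspaceT; exact: continuous_sep.
- split=> [z _|]; first by have [D _] := psi_is_derivet z; exact: D.
  rewrite (_ : dt psi = fun z => f z.1 * dg z.2); last exact/funext/dt_sep.
  by apply: continuous_subspaceT; exact: continuous_sep.
Qed.

End Separated.

(** * The bump and its first two derivatives in space *)

Definition sqnorm {R : realType} {n : nat} (q : 'rV[R]_n) : R :=
  \sum_(i < n) q ord0 i ^+ 2.

Section Bump.
Context {R : realType} {n : nat} (p : 'rV[R]_n) (rho : R).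

Definition parab (x : 'rV[R]_n) : R := rho ^+ 2 - sqnorm (x - p).

Lemma continuous_coord i : continuous (fun x : 'rV[R]_n => (x - p) ord0 i).
Proof.
have -> : (fun x : 'rV[R]_n => (x - p) ord0 i) =
    (fun x => x ord0 i) - cst (p ord0 i) by apply/funext => x; rewrite !mxE.
move=> x; apply: continuousB; last exact: cst_continuous.
exact: coord_continuous.
Qed.

Lemma continuous_parab : continuous parab.
Proof.
have -> : parab =
    cst (rho ^+ 2) - \sum_(i < n) (fun x : 'rV[R]_n => (x - p) ord0 i ^+ 2).
  by apply/funext => x; rewrite fctE /= fct_sumE.
move=> x; apply: continuousB; first exact: cst_continuous.
apply: (big_ind (fun f : 'rV[R]_n -> R => continuous_at x f)) => [|f g|i _].
- exact: cst_continuous.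
- exact: continuousD.
have -> : (fun x : 'rV[R]_n => (x - p) ord0 i ^+ 2) =
  (fun t => t ^+ 2) \o (fun x : 'rV[R]_n => (x - p) ord0 i) by [].
apply: continuous_comp; first exact: continuous_coord.
exact: exprn_continuous.
Qed.

Lemma is_derive_coord x i j :
  is_derive x (delta_mx ord0 i) (fun y : 'rV[R]_n => (y - p) ord0 j)
    (i == j)%:R.
Proof.
apply/is_derive_line.
rewrite (_ : (fun h => _) =
    (id : R -> R) * cst (i == j)%:R + cst ((x - p) ord0 j)).
  by apply: is_derive_eq; rewrite scaler0 addr0 add0r /= [LHS]mulr1.
by apply/funext => h; rewrite !fctE !mxE /= eq_sym addrA.
Qed.

Lemma is_derive_parab x i :
  is_derive x (delta_mx ord0 i) parab (- 2 * (x - p) ord0 i).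
Proof.
apply/is_derive_line.
(* Along a coordinate line [parab] is a quadratic polynomial in h, and only its linear term
   contributes at h = 0. *)
rewrite (_ : (fun h => _) = cst (parab x)
    + (cst (- 2 * (x - p) ord0 i) * (id : R -> R) - (id : R -> R) * id)).
  have Did := is_derive_id (0 : R) (1 : R).
  have := is_deriveD (is_derive_cst (parab x) (0 : R) (1 : R)) (is_deriveB
    (is_deriveM (is_derive_cst (- 2 * (x - p) ord0 i) (0 : R) (1 : R)) Did)
    (is_deriveM Did Did)).
  by rewrite /= !scale0r !addr0 subr0 add0r [_ *: 1]mulr1.
apply/funext => h; rewrite !fctE /parab /sqnorm.
have -> : \sum_(j < n) (h *: delta_mx ord0 i + x - p) ord0 j ^+ 2 =
    \sum_(j < n) (x - p) ord0 j ^+ 2 +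
    \sum_(j < n) (if j == i then h ^+ 2 + 2 * h * (x - p) ord0 i else 0).
  rewrite -big_split; apply: eq_bigr => j _; rewrite !mxE /=.
  by case: eqP => [->|_] /=; rewrite ?mulr1n ?mulr0n; ring.
by rewrite -big_mkcond big_pred1_eq; ring.
Qed.

(** Two differentiations lower the exponent to [nu.+1] >= 1, so the second derivatives remain
    continuous across the boundary of the ball, whatever [nu] is. *)
Definition bump nu (x : 'rV[R]_n) : R := pos_pow nu.+3 (parab x).

Definition dbump nu i (x : 'rV[R]_n) : R :=
  nu.+3%:R * pos_pow nu.+2 (parab x) * (- 2 * (x - p) ord0 i).

Definition d2bump nu i j (x : 'rV[R]_n) : R :=
  nu.+3%:R * (nu.+2%:R * pos_pow nu.+1 (parab x) * 4 *
      ((x - p) ord0 i * (x - p) ord0 j)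
    - 2 * pos_pow nu.+2 (parab x) * (i == j)%:R).

Lemma is_derive_bump nu x i :
  is_derive x (delta_mx ord0 i) (bump nu) (dbump nu i x).
Proof.
apply: is_derive_comp_dir; last exact: is_derive_parab.
exact: is_derive_pos_pow.
Qed.

Lemma is_derive_dbump nu x i j :
  is_derive x (delta_mx ord0 i) (dbump nu j) (d2bump nu i j x).
Proof.
have dc := is_derive_coord x i j.
have dP : is_derive x (delta_mx ord0 i) (pos_pow nu.+2 \o parab)
    (nu.+2%:R * pos_pow nu.+1 (parab x) * (- 2 * (x - p) ord0 i)).
  apply: is_derive_comp_dir; last exact: is_derive_parab.
  exact: is_derive_pos_pow.
suff : is_derive x (delta_mx ord0 i) ((- 2 * nu.+3%:R) \*:
    ((pos_pow nu.+2 \o parab) * (fun y : 'rV[R]_n => (y - p) ord0 j)))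
    (d2bump nu i j x).
  congr is_derive; apply/funext => y; rewrite /dbump /= !fctE /=.
  by move: (nu.+3%:R) (pos_pow _ _) => a b; rewrite /GRing.scale /=; ring.
have := is_deriveZ (- 2 * nu.+3%:R) (is_deriveM dP dc).
congr is_derive; rewrite /d2bump /GRing.scale /=.
move: (nu.+3%:R) (nu.+2%:R) (pos_pow _ _) (pos_pow _ _) => a b c d; ring.
Qed.

Lemma continuous_pos_pow_parab N : continuous (pos_pow N \o parab).
Proof.
move=> x; apply: continuous_comp; first exact: continuous_parab.
exact: continuous_pos_pow.
Qed.

Lemma continuous_bump nu : continuous (bump nu).
Proof. exact: continuous_pos_pow_parab. Qed.

Lemma continuous_dbump nu i : continuous (dbump nu i).
Proof.
have -> : dbump nu i = cst nu.+3%:R * (pos_pow nu.+2 \o parab) *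
  (cst (- 2) * (fun y : 'rV[R]_n => (y - p) ord0 i)) by [].
move=> x; apply: continuousM; apply: continuousM; try exact: cst_continuous.
  exact: continuous_pos_pow_parab.
exact: continuous_coord.
Qed.

Lemma continuous_d2bump nu i j : continuous (d2bump nu i j).
Proof.
have -> : d2bump nu i j = cst nu.+3%:R *
  (cst nu.+2%:R * (pos_pow nu.+1 \o parab) * cst 4 *
     ((fun y : 'rV[R]_n => (y - p) ord0 i) * (fun y => (y - p) ord0 j))
   - cst 2 * (pos_pow nu.+2 \o parab) * cst (i == j)%:R) by [].
move=> x; apply: continuousM; first exact: cst_continuous.
apply: continuousB; apply: continuousM; try exact: cst_continuous.
- apply: continuousM; last exact: cst_continuous.
  apply: continuousM; first exact: cst_continuous.
  exact: continuous_pos_pow_parab.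
- by apply: continuousM; exact: continuous_coord.
- apply: continuousM; first exact: cst_continuous.
  exact: continuous_pos_pow_parab.
Qed.

End Bump.

(** * Lower bound on H along the bump *)

Section SqNorm.
Context {R : realType} {n : nat}.
Implicit Types q : 'rV[R]_n.

Lemma sqnorm_ge0 q : 0 <= sqnorm q.
Proof. by apply: sumr_ge0 => i _; exact: sqr_ge0. Qed.

Lemma sqr_coord_le_sqnorm q i : q ord0 i ^+ 2 <= sqnorm q.
Proof.
rewrite /sqnorm (bigD1 i)//= lerDl; apply: sumr_ge0 => j _; exact: sqr_ge0.
Qed.

Lemma sqnormZ (a : R) q : sqnorm (a *: q) = a ^+ 2 * sqnorm q.
Proof. by rewrite /sqnorm big_distrr /=; apply: eq_bigr => i _;
  rewrite !mxE exprMn. Qed.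

Lemma sqr_enorm q : enorm q ^+ 2 = sqnorm q.
Proof. by rewrite sqr_sqrtr// sqnorm_ge0. Qed.

Lemma tensorE q i j : tensor q i j = q ord0 i * q ord0 j.
Proof. by rewrite /tensor mxE big_ord1 mxE. Qed.

Lemma tensorZ (a : R) q : tensor (a *: q) = a ^+ 2 *: tensor q.
Proof. by apply/matrixP => i j; rewrite !(tensorE, mxE); ring. Qed.

Lemma sym_tensor (a b : R) q : sym (a *: tensor q - b *: 1%:M).
Proof.
rewrite /sym /=; apply/matrixP => i j.
by rewrite !(tensorE, mxE) (mulrC (q ord0 j)) eq_sym.
Qed.

End SqNorm.

Section BumpDerivatives.
Context {R : realType} {n : nat} (p : 'rV[R]_n) (rho : R) (nu : nat).

Lemma row_dbump x : 0 <= parab p rho x ->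
  \row_i dbump p rho nu i x
    = - (2 * nu.+3%:R * parab p rho x ^+ nu.+2) *: (x - p).
Proof.
move=> w0; apply/rowP => i; rewrite mxE [RHS]mxE /dbump pos_powE//.
have E (a b c : R) : a * b * (- 2 * c) = - (2 * a * b) * c by ring.
exact: E.
Qed.

Lemma mx_d2bump x : 0 <= parab p rho x ->
  \matrix_(i, j) d2bump p rho nu i j x
    = (2 * nu.+3%:R * parab p rho x ^+ nu.+1) *:
        ((2 * nu.+2%:R) *: tensor (x - p) - parab p rho x *: 1%:M).
Proof.
move=> w0; apply/matrixP => i j; rewrite /d2bump !pos_powE//.
rewrite !(tensorE, mxE) (exprSr _ nu.+1).
have E (a b P w q k : R) : a * (b * P * 4 * q - 2 * (P * w) * k) =
  2 * a * P * (2 * b * q - w * k) by ring.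
exact: E.
Qed.

End BumpDerivatives.

Section Hamiltonian.
Context {R : realType} {n : nat} (H : 'rV[R]_n -> 'M[R]_n -> R) (k1 : R).
Hypotheses (hA : conditionA H) (hB : conditionB H k1) (hC : conditionC H).

(** The gradient factor [a] may have either sign; [row_dbump] supplies a negative one. *)
Lemma H_scale q X (a b : R) : sym X -> 0 < b ->
  H (a *: q) (b *: X) = `|a| `^ k1 * b * H q X.
Proof.
move=> sX b0; have sbX : sym (b *: X).
  by rewrite /sym /= linearZ /= (_ : X^T = X).
by rewrite ((hB.2 q _ sbX).1 a) ((hB.2 q _ sX).2 b b0) mulrA.
Qed.

(** Continuity at the origin bounds |H| by 1 on a small ball about (0, 0). A common factor [s]
    brings every admissible pair into that ball, and homogeneity undoes the scaling at the cost of
    (s^k1 s)^-1. *)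
Lemma H_bounded_below (A : R) : exists2 C : R, 0 <= C &
  forall (q : 'rV[R]_n) (X : 'M[R]_n), sym X -> (forall i, `|q ord0 i| <= 1) ->
    (forall i j, `|X i j| <= A) -> - C <= H q X.
Proof.
case: hA => cH H0 _.
have sym0 : [set pX : 'rV[R]_n * 'M[R]_n | sym pX.2] (0, 0).
  by rewrite /= /sym /= trmx0.
have /cvgrPdist_lt/(_ 1 ltr01) near0 := cH (0, 0).
have : within [set pX : 'rV[R]_n * 'M[R]_n | sym pX.2]
    (nbhs ((0, 0) : 'rV[R]_n * 'M[R]_n))
    [set t | `|H t.1 t.2| < 1].
  rewrite (nbhs_subspace_in sym0); apply: filterS near0 => t.
  by rewrite /from_subspace /= H0 sub0r normrN.
move=> /nbhs_ballP[d /= d0 dH].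
(* The bound 1 + |A| covers the entries of both [q] and [X] and is positive for every sign of [A];
   after scaling all entries are at most d/2. *)
pose s := d / (2 * (1 + `|A|)).
have A0 : 0 < 1 + `|A| by rewrite ltr_pwDl.
have s0 : 0 < s by rewrite divr_gt0// mulr_gt0.
exists (s `^ k1 * s)^-1; first by rewrite invr_ge0 mulr_ge0 ?powR_ge0 ?ltW.
move=> q X sX q1 XA.
have hs : s * (1 + `|A|) = d / 2 by rewrite /s; field; rewrite gt_eqF.
have small y : `|y| <= 1 + `|A| -> `|s * y| < d.
  move=> yA; rewrite normrM gtr0_norm//.
  by rewrite (@le_lt_trans _ _ (d / 2)) ?ltr_pdivrMr ?ltr_pMr ?ltr1n// -hs
    ler_pM2l.
have : `|H (s *: q) (s *: X)| < 1.
  apply: (dH (s *: q, s *: X));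
    last by rewrite /= /sym /= linearZ /= (_ : X^T = X).
  split; split => // i j; rewrite !mxE /ball /= sub0r normrN; apply: small.
    by rewrite (ord1 i) (le_trans (q1 j))// lerDl.
  by rewrite (le_trans (XA i j))// (le_trans (ler_norm A))// lerDr.
have K0 : 0 < s `^ k1 * s by rewrite mulr_gt0 ?powR_gt0.
rewrite H_scale// (gtr0_norm s0) ltr_norml => /andP[/ltW h _].
by rewrite -(ler_pM2l K0) mulrN divff ?gt_eqF.
Qed.

(** With e = q/|q| the matrix equals w (Lam e (x) e - I), where Lam = a |q|^2 / w >= a >= L. The
    second term of the maximum [MC Lam] < 0 makes H positive at (e, Lam e (x) e - I), and
    homogeneity transfers the sign. *)
Lemma H_radial : exists2 L : R, 1 <= L & forall (a w : R) (q : 'rV[R]_n),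
  L <= a -> 0 < w <= sqnorm q -> 0 <= H q (a *: tensor q - w *: 1%:M).
Proof.
case: hC => _ [L [L1 HL]]; exists L => // a w q La /andP[w0 wq].
have r0 : 0 < enorm q by rewrite sqrtr_gt0 (lt_le_trans w0).
pose e := (enorm q)^-1 *: q.
have qe : q = enorm q *: e by rewrite scalerA divff ?scale1r ?gt_eqF.
have e1 : enorm e = 1.
  apply/eqP; rewrite -sqrp_eq1 ?sqrtr_ge0// sqr_enorm sqnormZ -sqr_enorm.
  by rewrite -exprMn mulVf ?(gt_eqF r0)// expr1n.
pose Lam := a * enorm q ^+ 2 / w.
have LLam : L <= Lam.
  rewrite /Lam ler_pdivlMr// sqr_enorm.
  by apply: ler_pM => //; [exact: le_trans L1|exact: ltW].
have : 0 < H e (Lam *: tensor e - 1%:M).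
  have := HL _ LLam; rewrite /MC gt_max => /andP[_]; rewrite oppr_lt0.
  set A := [set _ | _ in _] => infA.
  (* inf of a set without lower bound is 0, so infA makes A bounded below *)
  have hinf : has_inf A by apply: contrapT => /inf_out A0; move: infA;
    rewrite A0 ltxx.
  by apply: lt_le_trans infA _; apply: ge_inf; [exact: hinf.2|exists e].
have -> : a *: tensor q - w *: 1%:M = w *: (Lam *: tensor e - 1%:M).
  rewrite [in LHS]qe tensorZ scalerBr !scalerA; congr (_ *: _ - _).
  by rewrite /Lam [RHS]mulrCA divff ?mulr1// gt_eqF.
move=> He; rewrite [X in H X]qe H_scale//; last first.
  by have := sym_tensor Lam 1 e; rewrite scale1r.
by rewrite !mulr_ge0 ?powR_ge0 ?(ltW w0) ?(ltW He).
Qed.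

(** [nu] is fixed by [H] alone and [C] by [rho]. Neither depends on [s], because the factor [s]
    enters both sides with the same degree k1 + 1. *)
Lemma H_bump_ge : exists nu : nat, forall rho : R, 0 < rho <= 1 ->
  exists2 C : R, 0 <= C & forall (p x : 'rV[R]_n) (s : R),
    0 < s -> 0 < parab p rho x ->
    - (C * ((s * bump p rho nu x) `^ k1 * (s * bump p rho nu x))) <=
    H (s *: \row_i dbump p rho nu i x)
      (s *: \matrix_(i, j) d2bump p rho nu i j x).
Proof.
have k10 : 0 <= k1 by case: hB.
have [L L1 HL] := H_radial.
(* In [mx_d2bump] the tensor has coefficient 2 (nu + 2), which must reach the threshold L of
   [H_radial]. *)
pose nu := Num.truncn L; exists nu => rho /andP[rho0 rho1].
have Lnu : L <= 2 * nu.+2%:R.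
  have /ltW h := truncnS_gt L.
  by rewrite (le_trans h)// -natrM ler_nat mul2n -addnn (leq_trans _ (leq_addr
    _ _)).
have [C0 C00 HC0] := H_bounded_below (2 * nu.+2%:R + 1).
(* In the inner region |q|^2 < w the identity w + |q|^2 = rho^2 gives w > d. *)
have [d dE] : exists d, d = rho ^+ 2 / 2 by exists (rho ^+ 2 / 2).
have d0 : 0 < d by rewrite dE divr_gt0// exprn_gt0.
have r21 : rho ^+ 2 <= 1 by rewrite expr_le1// ltW.
have d1 : d <= 1 by rewrite dE ler_pdivrMr// mul1r (le_trans r21)// ler1n.
have [B BE] : exists B, B = 2 * nu.+3%:R / d ^+ 2
  by exists (2 * nu.+3%:R / d ^+ 2).
have B0 : 0 < B by rewrite BE divr_gt0 ?exprn_gt0// mulr_gt0.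
have BC0 : 0 <= B `^ k1 * B * C0.
  by apply: mulr_ge0 => //; apply: mulr_ge0; rewrite ?powR_ge0 ?(ltW B0).
exists (B `^ k1 * B * C0) => //.
move=> p x s s0 w0.
have w0' := ltW w0.
rewrite row_dbump// mx_d2bump// /bump pos_powE// !scalerA.
have wq2 : parab p rho x = rho ^+ 2 - sqnorm (x - p) by [].
move: (parab p rho x) (x - p) w0 w0' wq2 => w q w0 w0' wq2.
have sX := sym_tensor (2 * nu.+2%:R) w q.
have v0 : 0 < s * w ^+ nu.+3 by rewrite mulr_gt0// exprn_gt0.
have sigma0 : 0 < s * (2 * nu.+3%:R * w ^+ nu.+1).
  by rewrite !mulr_gt0// exprn_gt0.
rewrite H_scale//.
(* In the outer region [H_radial] makes the right side nonnegative, while the claimed lower bound is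
   nonpositive. The inner region needs the quantitative estimate. *)
have [qw|wq] := leP w (sqnorm q).
  apply: (@le_trans _ _ 0).
    rewrite oppr_le0; apply: mulr_ge0 => //.
    by apply: mulr_ge0; rewrite ?powR_ge0 ?(ltW v0).
  rewrite mulr_ge0// ?HL ?w0//.
  by rewrite mulr_ge0 ?powR_ge0// ltW.
have dw : d <= w by rewrite dE ler_pdivrMr//; lra.
have q2 : sqnorm q <= 1 by have := sqnorm_ge0 q; lra.
have q1 i : `|q ord0 i| <= 1.
  rewrite -(@expr_le1 _ 2)// -normrX ger0_norm ?sqr_ge0//.
  exact: le_trans (sqr_coord_le_sqnorm q i) q2.
have w1 : w <= 1 by have := sqnorm_ge0 q; lra.
have := HC0 q _ sX q1.
set X := (_ *: tensor q - _) => /(_ _)/wrap[].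
  move=> i j; rewrite !(tensorE, mxE) (le_trans (ler_normB _ _))// lerD//.
    have c0 : 0 <= 2 * nu.+2%:R :> R by rewrite -natrM.
    by rewrite normrM (ger0_norm c0) ler_piMr// normrM mulr_ile1 ?q1.
  by rewrite normrM (gtr0_norm w0) mulr_ile1 ?(ltW w0)//; case: (i == j);
    rewrite ?normr1 ?normr0.
move=> HX.
(* [th] and [sg] scale the gradient and the Hessian, and [v] is the barrier value. Since |th| w and
   sg w^2 both equal 2 (nu + 3) v, the bounds w >= d and d <= 1 give |th|, sg <= B v. *)
set th := s * - _; set sg := s * (_ * w ^+ _) in sigma0 *.
set v := s * w ^+ _ in v0 *.
have d2w : d ^+ 2 <= w by nra.
have d2w2 : d ^+ 2 <= w ^+ 2 by nra.
have sgB : sg <= B * v.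
  rewrite /sg BE /v [leRHS]mulrAC ler_pdivlMr ?exprn_gt0//.
  rewrite (_ : _ * (s * _) = s * (2 * nu.+3%:R * w ^+ nu.+1) * w ^+ 2);
    last first.
    have -> : w ^+ nu.+3 = w ^+ 2 * w ^+ nu.+1 by rewrite -exprD.
    by move: (w ^+ nu.+1) (nu.+3%:R) => a b; ring.
  by rewrite ler_pM2l.
have thB : `|th| <= B * v.
  have -> : `|th| = s * (2 * nu.+3%:R * w ^+ nu.+2).
    by rewrite /th mulrN normrN ger0_norm// mulr_ge0 ?(ltW s0)// mulr_ge0
      ?exprn_ge0// mulr_ge0.
  rewrite BE /v [leRHS]mulrAC ler_pdivlMr ?exprn_gt0//.
  rewrite (_ : _ * (s * _) = s * (2 * nu.+3%:R * w ^+ nu.+2) * w); last first.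
    by rewrite [w ^+ nu.+3]exprSr; move: (w ^+ nu.+2) (nu.+3%:R) => a b; ring.
  by rewrite ler_pM2l// mulr_gt0 ?s0// mulr_gt0 ?exprn_gt0// mulr_gt0.
have : `|th| `^ k1 * sg <= B `^ k1 * B * (v `^ k1 * v).
  have -> : B `^ k1 * B * (v `^ k1 * v) = (B * v) `^ k1 * (B * v).
    by rewrite (powRM _ (ltW B0) (ltW v0)); move: (B `^ k1) (v `^ k1) => a b;
      ring.
  apply: ler_pM; rewrite ?powR_ge0 ?(ltW sigma0)//.
  by apply: ge0_ler_powR; rewrite ?nnegrE// mulr_ge0// ltW.
have : 0 <= `|th| `^ k1 * sg by rewrite mulr_ge0 ?powR_ge0// ltW.
move: (`|th| `^ k1 * sg) (B `^ k1 * B) (v `^ k1 * v) HX => a b c; nra.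
Qed.

End Hamiltonian.

(** * The time profile *)

Section TimeProfile.
Context {R : realType} (lam K1 K2 c1 c2 : R).

(** The cutoffs subtract truncated squares, which keeps the function C^1. The profile may become
    negative away from [c1, c2] instead of vanishing; contact is only studied where it is
    positive. *)
Definition profile (t : R) : R :=
  expR (- lam * t) - K1 * pos_pow 2 (c1 - t) - K2 * pos_pow 2 (t - c2).

Definition dprofile (t : R) : R :=
  - lam * expR (- lam * t) + 2 * K1 * pos_pow 1 (c1 - t)
  - 2 * K2 * pos_pow 1 (t - c2).

Let is_derive_affine (a b t : R) : is_derive t 1 (fun x : R => a * x + b) a.
Proof.
suff : is_derive t 1 (cst a * (id : R -> R) + cst b) a by [].
by apply: is_derive_eq; rewrite scaler0 !addr0 [LHS]mulr1.
Qed.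

Let profileE : profile = (fun t => expR (- lam * t + 0)
  - K1 * pos_pow 2 (- 1 * t + c1) - K2 * pos_pow 2 (1 * t + (- c2))).
Proof. by apply/funext => t; rewrite addr0 mulN1r mul1r [- t + _]addrC. Qed.

Let dprofileE : dprofile = (fun t => - lam * expR (- lam * t + 0)
  + 2 * K1 * pos_pow 1 (- 1 * t + c1) - 2 * K2 * pos_pow 1 (1 * t + (- c2))).
Proof. by apply/funext => t; rewrite addr0 mulN1r mul1r [- t + _]addrC. Qed.

Lemma is_derive_profile (t : R) : is_derive t 1 profile (dprofile t).
Proof.
rewrite profileE dprofileE.
have dE : is_derive t 1 (expR \o (fun x => - lam * x + 0))
    (expR (- lam * t + 0) * - lam).
  by apply: is_derive_comp_dir; exact: is_derive_affine.
have d1 : is_derive t 1 (pos_pow 2 \o (fun x => - 1 * x + c1))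
    (2 * pos_pow 1 (- 1 * t + c1) * - 1).
  by apply: is_derive_comp_dir;
    [exact: is_derive_pos_pow|exact: is_derive_affine].
have d2 : is_derive t 1 (pos_pow 2 \o (fun x => 1 * x + (- c2)))
    (2 * pos_pow 1 (1 * t + (- c2)) * 1).
  by apply: is_derive_comp_dir;
    [exact: is_derive_pos_pow|exact: is_derive_affine].
suff : is_derive t 1 ((expR \o (fun x => - lam * x + 0))
    - cst K1 * (pos_pow 2 \o (fun x => - 1 * x + c1))
    - cst K2 * (pos_pow 2 \o (fun x => 1 * x + (- c2))))
  (- lam * expR (- lam * t + 0)
  + 2 * K1 * pos_pow 1 (- 1 * t + c1) - 2 * K2 * pos_pow 1 (1 * t + (- c2)))
    by [].
apply: is_derive_eq; rewrite !fctE /GRing.scale /=.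
move: (expR _) (pos_pow 1 (- 1 * t + c1)) (pos_pow 1 (1 * t + (- c2))) => x y z.
move: (pos_pow 2 _) (pos_pow 2 _) => x' y'; ring.
Qed.

Let continuous_affine (a b : R) : continuous (fun x : R => a * x + b).
Proof.
have -> : (fun x : R => a * x + b) = cst a * (id : R -> R) + cst b by [].
move=> x; apply: continuousD; last exact: cst_continuous.
by apply: continuousM; [exact: cst_continuous|exact: cvg_id].
Qed.

Let continuous_pos_affine N (a b : R) :
  continuous (pos_pow N \o (fun x : R => a * x + b)).
Proof.
move=> x; apply: continuous_comp; first exact: continuous_affine.
exact: continuous_pos_pow.
Qed.

Let continuous_exp_affine (a b : R) :
  continuous (expR \o (fun x : R => a * x + b)).
Proof.
move=> x; apply: continuous_comp; first exact: continuous_affine.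
exact: continuous_expR.
Qed.

Let continuous_comb (a b c : R) (f g h : R -> R) :
  continuous f -> continuous g -> continuous h ->
  continuous (fun t => a * f t + b * g t - c * h t).
Proof.
move=> cf cg ch.
have -> : (fun t => a * f t + b * g t - c * h t) =
  cst a * f + cst b * g - cst c * h by [].
move=> t; apply: continuousB; first apply: continuousD.
all: apply: continuousM; first exact: cst_continuous.
- exact: cf.
- exact: cg.
- exact: ch.
Qed.

Lemma continuous_profile : continuous profile.
Proof.
have -> : profile = (fun t => 1 * (expR \o (fun x => - lam * x + 0)) t
    + - K1 * (pos_pow 2 \o (fun x => - 1 * x + c1)) t
    - K2 * (pos_pow 2 \o (fun x => 1 * x + (- c2))) t).
  by rewrite profileE; apply/funext => t /=;
    rewrite [1 * expR _]mul1r [- K1 * _]mulNr.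
exact: continuous_comb.
Qed.

Lemma continuous_dprofile : continuous dprofile.
Proof.
by rewrite dprofileE; exact: (continuous_comb (- lam) (2 * K1) (2 * K2) _ _ _
  (continuous_exp_affine _ _) (continuous_pos_affine _ _ _)
  (continuous_pos_affine _ _ _)).
Qed.

Hypotheses (lam0 : 0 <= lam) (K10 : 0 <= K1) (K20 : 0 <= K2).

Lemma profile_le_exp t : profile t <= expR (- lam * t).
Proof.
rewrite /profile; have := mulr_ge0 K10 (pos_pow_ge0 2 (c1 - t)).
by have := mulr_ge0 K20 (pos_pow_ge0 2 (t - c2)); lra.
Qed.

Lemma profile_le1 t : 0 <= t -> profile t <= 1.
Proof.
move=> t0; apply: le_trans (profile_le_exp t) _.
by rewrite -expR0 ler_expR mulNr oppr_le0 mulr_ge0.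
Qed.

(** After [c1] only the cutoff at [c2] can be active: it lowers the derivative and raises - lam
    times the profile. Before [c1] the other cutoff pushes the derivative up, so contact there has
    to be excluded by other means. *)
Lemma dprofile_le t : c1 <= t -> dprofile t <= - lam * profile t.
Proof.
move=> ct; rewrite /dprofile /profile !(@pos_pow0 _ _ (c1 - t)) ?subr_le0//.
have := pos_pow_ge0 1 (t - c2); have := pos_pow_ge0 2 (t - c2).
move: (pos_pow _ _) (pos_pow _ _) => x y x0 y0.
have := mulr_ge0 lam0 (mulr_ge0 K20 x0); have := mulr_ge0 K20 y0.
by move: (expR _) => E; lra.
Qed.

Lemma profileE_mid t : c1 <= t <= c2 -> profile t = expR (- lam * t).
Proof.
move=> /andP[t1 t2]; rewrite /profile !pos_pow0 ?subr_le0//.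
by rewrite !mulr0 !subr0.
Qed.

Lemma profile_le0_before (a t : R) : 1 <= K1 * (c1 - a) ^+ 2 -> a <= c1 ->
  0 <= t <= a -> profile t <= 0.
Proof.
move=> h ac /andP[t0 ta]; have e1 : expR (- lam * t) <= 1.
  by rewrite -expR0 ler_expR mulNr oppr_le0 mulr_ge0.
have p2 : 1 <= K1 * pos_pow 2 (c1 - t).
  rewrite pos_powE ?subr_ge0 ?(le_trans ta)//; apply: le_trans h _.
  by rewrite ler_wpM2l// lerXn2r ?nnegrE ?subr_ge0 ?(le_trans ta)// lerB.
by rewrite /profile; have := mulr_ge0 K20 (pos_pow_ge0 2 (t - c2)); lra.
Qed.

Lemma profile_le0_after (b t : R) : 1 <= K2 * (b - c2) ^+ 2 -> c2 <= b ->
  0 <= t -> b <= t -> profile t <= 0.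
Proof.
move=> h cb t0 bt; have e1 : expR (- lam * t) <= 1.
  by rewrite -expR0 ler_expR mulNr oppr_le0 mulr_ge0.
have p2 : 1 <= K2 * pos_pow 2 (t - c2).
  rewrite pos_powE ?subr_ge0 ?(le_trans cb)//; apply: le_trans h _.
  by rewrite ler_wpM2l// lerXn2r ?nnegrE ?subr_ge0 ?(le_trans cb)// lerB.
by rewrite /profile; have := mulr_ge0 K10 (pos_pow_ge0 2 (c1 - t)); lra.
Qed.

End TimeProfile.

(** * Comparison with the barriers *)

Section Contact.
Context {R : realType} {n : nat}.
Variables (p : 'rV[R]_n) (rho : R) (nu : nat).

Lemma bump_ge0 x : 0 <= bump p rho nu x.
Proof. exact: pos_pow_ge0. Qed.

Lemma bump_gt0 x : (0 < bump p rho nu x) = (0 < parab p rho x).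
Proof.
have [w0|w0] := ltP 0 (parab p rho x).
  by rewrite /bump pos_powE ?(ltW w0)// exprn_gt0.
by rewrite /bump pos_pow0// ltxx.
Qed.

Lemma bump_le1 x : 0 <= rho <= 1 -> bump p rho nu x <= 1.
Proof.
move=> /andP[rho0 rho1]; have [w0|w0] := leP 0 (parab p rho x); last first.
  by rewrite /bump pos_pow0 ?(ltW w0).
rewrite /bump pos_powE// exprn_ile1// lerBlDr.
by rewrite (le_trans (exprn_ile1 _ _ _))// lerDl sqnorm_ge0.
Qed.

Lemma parab_coord x i : 0 <= rho -> 0 <= parab p rho x ->
  `|x ord0 i - p ord0 i| <= rho.
Proof.
move=> rho0; rewrite subr_ge0 => /(le_trans (sqr_coord_le_sqnorm (x - p) i)).
by rewrite !mxE => h; rewrite -ler_sqr ?nnegrE// real_normK ?num_real.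
Qed.

Lemma compact_parab_ge0 : 0 <= rho -> compact [set x | 0 <= parab p rho x].
Proof.
move=> rho0.
have cpt : compact [set v : 'rV[R]_n |
    forall i, v ord0 i \in `[p ord0 i - rho, p ord0 i + rho]].
  apply: (@rV_compact _ _
    (fun i => `[p ord0 i - rho, p ord0 i + rho]%classic)).
  by move=> i; exact: segment_compact.
apply: (subclosed_compact _ cpt).
  apply: (@closed_comp _ _ (parab p rho) [set y | 0 <= y]) => [x _|].
    exact: continuous_parab.
  exact: closed_ge.
by move=> x /= w0 i; rewrite in_itv /= -ler_distlC distrC parab_coord.
Qed.

(** At a contact point with barrier value v, the supersolution inequality, the decay of [g] and u >=
    v give H <= u^k1 psi_t <= - lam u^k1 v <= - lam v^k < - C v^k, against the lower bound [HC]
    taken at s = g(t). *)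
Lemma no_contact (H : 'rV[R]_n -> 'M[R]_n -> R) (k1 k C lam m : R)
    (A : set ('rV[R]_n * R)) (u : 'rV[R]_n * R -> R) (g dg : R -> R)
    (z : 'rV[R]_n * R) :
  k = k1 + 1 -> 0 <= k1 -> 0 <= C ->
  (forall (x : 'rV[R]_n) (s : R), 0 < s -> 0 < parab p rho x ->
    - (C * ((s * bump p rho nu x) `^ k1 * (s * bump p rho nu x))) <=
    H (s *: \row_i dbump p rho nu i x)
      (s *: \matrix_(i, j) d2bump p rho nu i j x)) ->
  C < lam ->
  viscosity_supersolution H k A u ->
  (forall t : R, is_derive t 1 g (dg t)) -> continuous g -> continuous dg ->
  min_on A (fun w => u w - (m + bump p rho nu w.1 * g w.2)) z ->
  0 < bump p rho nu z.1 * g z.2 -> dg z.2 <= - lam * g z.2 ->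
  bump p rho nu z.1 * g z.2 <= u z -> False.
Proof.
move=> kE k10 C0 HC Clam super gD gC dgC zmin v0 dgz uz.
have b0 : 0 < bump p rho nu z.1.
  by rewrite lt_neqAle bump_ge0 andbT eq_sym; apply: contraTneq v0 => ->;
    rewrite mul0r ltxx.
have g0 : 0 < g z.2 by rewrite -(pmulr_rgt0 _ b0).
have bD := is_derive_bump p rho nu; have dbD := is_derive_dbump p rho nu.
have bC := @continuous_bump R n p rho nu.
have dbC := @continuous_dbump R n p rho nu.
have d2bC := @continuous_d2bump R n p rho nu.
have := super _ _ (C2x1t_sep _ _ _ _ _ m bD dbD gD bC dbC d2bC gC dgC A) zmin.
rewrite (gradx_sep _ _ g m bD z) (hessx_sep _ _ _ g m bD dbD z).
rewrite (dt_sep _ g dg m gD z) kE addrK.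
rewrite bump_gt0 in b0; have := HC _ _ g0 b0; rewrite -bump_gt0 in b0.
set h := H _ _; rewrite [g z.2 * _]mulrC; set v := _ * g z.2 in v0 uz *.
have vu : v `^ k1 <= u z `^ k1.
  by apply: ge0_ler_powR; rewrite ?nnegrE ?(ltW v0)// (le_trans (ltW v0)).
have vk0 : 0 < v `^ k1 by rewrite powR_gt0.
have bdg : bump p rho nu z.1 * dg z.2 <= - lam * v.
  by rewrite /v mulrCA ler_pM2l.
move: (v `^ k1) (u z `^ k1) (bump _ _ _ _ * dg _) vu vk0 bdg
  => a b c ab a0 cv h1 h2.
have cv' : C * v < - c by rewrite (lt_le_trans _ (_ : lam * v
  <= _))// ?ltr_pM2r//; lra.
have c0 : 0 < - c by apply: le_lt_trans cv'; rewrite mulr_ge0// ltW.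
have : a * (C * v) < a * - c by rewrite ltr_pM2l.
have : a * - c <= b * - c by rewrite ler_pM2r.
rewrite -/h in h1 h2; lra.
Qed.

End Contact.

(** Restates lower semicontinuity on the subspace as the relative neighbourhood condition that
    [lsc_compact_argmin] takes. *)
Lemma lsc_on_near {R : realType} {n : nat} (A : set ('rV[R]_n * R))
    (u : 'rV[R]_n * R -> R) z (a : R) :
  lsc_on A u -> A z -> a < u z -> \forall w \near z, A w -> a < u w.
Proof.
move=> lsc Az auz; have [|V Vz Va] := lsc z a; first by rewrite lte_fin.
have VA : within A (nbhs z) V by rewrite (nbhs_subspace_in Az).
apply: (@filterS _ (nbhs z) _ (fun w => A w -> V w)) VA => w Vw Aw.
by have := Va w (Vw Aw); rewrite lte_fin.
Qed.

Section Barrier.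
Context {R : realType} {n : nat} (Omega : set 'rV[R]_n) (T : R).
Variables (H : 'rV[R]_n -> 'M[R]_n -> R) (k1 k C : R) (nu : nat).
Variables (u : 'rV[R]_n * R -> R) (m : R).
Variables (p : 'rV[R]_n) (rho a c1 c2 b : R).
Let A := cylinder Omega T.
Hypotheses (kE : k = k1 + 1) (k10 : 0 <= k1) (C0 : 0 <= C)
  (HC : forall (x : 'rV[R]_n) (s : R), 0 < s -> 0 < parab p rho x ->
    - (C * ((s * bump p rho nu x) `^ k1 * (s * bump p rho nu x))) <=
    H (s *: \row_i dbump p rho nu i x)
      (s *: \matrix_(i, j) d2bump p rho nu i j x))
  (super : viscosity_supersolution H k A u)
  (u_ge : forall z, A z -> m <= u z).
Hypotheses (rho01 : 0 < rho <= 1) (a0 : 0 < a) (ac1 : a < c1)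
  (c2b : c2 < b) (bT : b < T)
  (subOmega : [set x | 0 <= parab p rho x] `<=` Omega).

(** The rate C + 1 is a choice above [C]. The cutoff coefficients make the subtracted squares equal
    to 1 at t = a and at t = b, which is enough to beat the exponential, so [g] <= 0 on [0, a] and
    from b on. *)
Let g := profile (C + 1) ((c1 - a) ^- 2) ((b - c2) ^- 2) c1 c2.
Let dg := dprofile (C + 1) ((c1 - a) ^- 2) ((b - c2) ^- 2) c1 c2.
Let Psi (z : 'rV[R]_n * R) := bump p rho nu z.1 * g z.2.
Let K := [set x | 0 <= parab p rho x] `*` `[a, b]%classic.

Let lam0 : 0 <= C + 1. Proof. by rewrite addr_ge0. Qed.
Let K10 : 0 <= (c1 - a) ^- 2.
Proof. by rewrite invr_ge0 sqr_ge0. Qed.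
Let K20 : 0 <= (b - c2) ^- 2.
Proof. by rewrite invr_ge0 sqr_ge0. Qed.
Let rho0 : 0 <= rho. Proof. by case/andP: rho01 => /ltW. Qed.

Let KA : K `<=` A.
Proof.
case=> x t [/= w0]; rewrite in_itv /= => /andP[at_ tb].
by split; [exact: subOmega|rewrite /= (lt_le_trans a0)//= (le_lt_trans tb)].
Qed.

Let compactK : compact K.
Proof.
by apply: compact_setX; [exact: compact_parab_ge0|exact: segment_compact].
Qed.

(** Confines the positive set of [Psi] to the compact set [K], so that extrema found on [K] can be
    extended to the whole cylinder. *)
Let Psi_gt0 z : A z -> 0 < Psi z -> K z /\ 0 < g z.2.
Proof.
case: z => x t [Ox /andP[/= t0 tT]] Pz.
have b0 : 0 < bump p rho nu x.
  rewrite lt_neqAle bump_ge0 andbT eq_sym; apply: contraTneq Pz.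
  by rewrite /Psi /= => ->; rewrite mul0r ltxx.
have g0 : 0 < g t by rewrite -(pmulr_rgt0 _ b0).
split=> //; split=> /=; first by rewrite ltW// -(bump_gt0 p rho nu).
rewrite in_itv /=; apply/andP; split; rewrite leNgt; apply/negP => h.
- suff : g t <= 0 by rewrite leNgt g0.
  apply: (@profile_le0_before _ _ _ _ _ _ lam0 K10 K20 a).
  + by rewrite mulVf// sqrf_eq0 subr_eq0 gt_eqF.
  + exact: ltW.
  + by rewrite !ltW.
- suff : g t <= 0 by rewrite leNgt g0.
  apply: (@profile_le0_after _ _ _ _ _ _ lam0 K10 K20 b).
  + by rewrite mulVf// sqrf_eq0 subr_eq0 gt_eqF.
  + exact: ltW.
  + exact: ltW.
  + exact: ltW.
Qed.

Let Psi_le1 z : A z -> Psi z <= 1.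
Proof.
case: z => x t [Ox /andP[/= t0 tT]].
have g1 : g t <= 1 by apply: profile_le1 => //; exact: ltW.
have [g0|g0] := leP 0 (g t).
  by rewrite mulr_ile1// ?bump_ge0// bump_le1// rho0; case/andP: rho01.
by apply: (@le_trans _ _ 0) => //; rewrite mulr_ge0_le0 ?bump_ge0// ltW.
Qed.

(** The amplitude [e] is absorbed into the time profile, since [no_contact] accepts any profile with
    the decay property. *)
Let no_contact_Psi e z : 0 < e -> min_on A (fun w => u w - (m + e * Psi w)) z ->
  0 < Psi z -> c1 <= z.2 -> e * Psi z <= u z -> False.
Proof.
move=> e0 zmin Pz cz uz.
have EP w : e * Psi w = bump p rho nu w.1 * (e * g w.2) by rewrite /Psi mulrCA.
have Az := zmin.1; have [_ g0] := Psi_gt0 _ Az Pz.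
refine (@no_contact _ _ p rho nu H k1 k C (C + 1) m A u (fun t => e * g t)
  (fun t => e * dg t) z kE k10 C0 HC _ super _ _ _ _ _ _ _).
- by rewrite ltrDl.
- move=> t; suff : is_derive t 1 (cst e * g) (e * dg t) by [].
  have gD : is_derive t 1 g (dg t) by exact: is_derive_profile.
  by apply: is_derive_eq; rewrite scaler0 addr0.
- have -> : (fun t => e * g t) = cst e * g by [].
  move=> t; apply: continuousM; first exact: cst_continuous.
  exact: continuous_profile.
- have -> : (fun t => e * dg t) = cst e * dg by [].
  move=> t; apply: continuousM; first exact: cst_continuous.
  exact: continuous_dprofile.
- split=> // w Aw; rewrite -!EP; exact: zmin.2.
- by rewrite -EP mulr_gt0.
- by rewrite mulrCA ler_pM2l//; exact: dprofile_le.
- by rewrite -EP.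
Qed.

Let g_mid t : c1 <= t <= c2 -> g t = expR (- (C + 1) * t).
Proof. exact: profileE_mid. Qed.

Let continuous_Psi : continuous Psi.
Proof.
have -> : Psi = (bump p rho nu \o fst) * (g \o snd) by [].
move=> z; apply: continuousM.
  by apply: continuous_comp; [exact: cvg_fst|exact: continuous_bump].
by apply: continuous_comp; [exact: cvg_snd|exact: continuous_profile].
Qed.

Lemma barrier_pos (e : R) (x : 'rV[R]_n) (t : R) :
  0 < e <= m -> lsc_on A u ->
  (forall y s, 0 <= parab p rho y -> a <= s <= c1 -> m + e <= u (y, s)) ->
  0 <= parab p rho x -> c1 <= t <= c2 ->
  m + e * (bump p rho nu x * expR (- (C + 1) * t)) <= u (x, t).
Proof.
move=> /andP[e0 em] lsc bottom wx tc; have /andP[tc1 tc2] := tc.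
rewrite -g_mid// leNgt; apply/negP => ult.
pose f z := u z - (m + e * Psi z).
have Kxt : K (x, t).
  by split => //=; rewrite in_itv /= (le_trans (ltW ac1))//= (le_trans tc2)//
    ltW.
have ePsi z : A z -> e * Psi z <= e.
  by move=> Az; rewrite ler_piMr ?(ltW e0)// Psi_le1.
have [z Kz zmin] : exists2 z, K z & forall w, K w -> f z <= f w.
  apply: (@lsc_compact_argmin _ _ f K (- e)) => //; first by exists (x, t).
    by move=> w /KA Aw; have := ePsi _ Aw; have := u_ge _ Aw; rewrite /f; lra.
  move=> w r Kw; rewrite /f => rfw.
  (* Half of the gap pays for a drop of [u], the other half for the oscillation of [e * Psi]. *)
  pose d := (u w - (m + e * Psi w) - r) / 2.
  have d0 : 0 < d by rewrite divr_gt0// subr_gt0.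
  have nu1 : \forall y \near w, A y -> u w - d < u y.
    by apply: lsc_on_near => //; [exact: KA|rewrite ltrBlDr ltrDl].
  have cw : {for w, continuous (cst e * Psi)}.
    by apply: continuousM; [exact: cst_continuous|exact: continuous_Psi].
  have nu2 : \forall y \near w, `|e * Psi w - e * Psi y| < d.
    by move/cvgrPdist_lt : cw => /(_ _ d0).
  near=> y => Ky; have Ay := KA _ Ky.
  have h1 : u w - d < u y by move: Ay; near: y.
  have h2 : `|e * Psi w - e * Psi y| < d by near: y.
  by move: h1 h2; rewrite /d ltr_norml => h1 /andP[h2 h3]; lra.
have Az := KA _ Kz.
have fz0 : f z < 0 by apply: le_lt_trans (zmin _ Kxt) _; rewrite subr_lt0.
have uz := u_ge _ Az.
have Pz : 0 < Psi z by rewrite -(pmulr_rgt0 _ e0); move: fz0; rewrite /f; lra.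
apply: (@no_contact_Psi e z) => //.
(* Where [Psi] <= 0, u >= m gives f >= 0 > f(z), so the minimum over [K] is a minimum over the whole
   cylinder. *)
- split=> // w Aw; have [|Pw] := ltP 0 (Psi w).
    by move=> /(Psi_gt0 _ Aw)[Kw _]; exact: zmin.
  apply: le_trans (ltW fz0) _; rewrite subr_ge0.
  by apply: le_trans (u_ge _ Aw); rewrite gerDl pmulr_rle0.
(* Before [c1] the hypothesis [bottom] gives f >= e - e Psi >= 0, contrary to f(z) < 0. *)
- rewrite leNgt; apply/negP => zc;
  case: z Kz {zmin} Az fz0 uz Pz zc => y s [/= wy].
  rewrite in_itv /= => /andP[as_ _] Az fz0 _ _ sc.
  have := bottom y s wy; rewrite as_ (ltW sc) => /(_ isT).
  by have := ePsi _ Az; move: fz0; rewrite /f; lra.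
- by apply: le_trans (ePsi _ Az) _; exact: le_trans em uz.
Unshelve. all: by end_near. Qed.

Lemma barrier_zero (e : R) (x : 'rV[R]_n) (t : R) :
  0 < e -> m = 0 -> {within A, continuous u} ->
  (forall z, K z -> 0 < u z) ->
  (forall y s, 0 <= parab p rho y -> a <= s <= c1 -> e <= u (y, s)) ->
  0 <= parab p rho x -> c1 <= t <= c2 ->
  e * (bump p rho nu x * expR (- (C + 1) * t)) <= u (x, t).
Proof.
move=> e0 m0 uC u0 bottom wx tc; have /andP[tc1 tc2] := tc.
rewrite -g_mid// leNgt; apply/negP => ult.
have Kxt : K (x, t).
  by split => //=; rewrite in_itv /= (le_trans (ltW ac1))//= (le_trans tc2)//
    ltW.
(* The maximum of Psi / u is the inverse of the largest s with s Psi <= u. *)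
have [z Kz zmax] : exists2 z, z \in K
  & forall w, w \in K -> Psi w / u w <= Psi z / u z.
  apply: (compact_EVT_max (f := fun w => Psi w / u w)) => //;
    first by exists (x, t).
  rewrite continuous_subspace_in => w; rewrite inE => Kw.
  have uCK : {within K, continuous u} by exact: continuous_subspaceW KA uC.
  apply: cvgM; first by apply: continuous_subspaceT; exact: continuous_Psi.
  by apply: cvgV; [rewrite gt_eqF ?u0|exact: uCK].
rewrite inE in Kz; have uz := u0 _ Kz; have Az := KA _ Kz.
have zmax' w : K w -> Psi w / u w <= Psi z / u z by move=> Kw; apply: zmax;
  rewrite inE.
(* Failure of the bound at (x, t) says Psi/u > 1/e there; the maximum is at least as large, hence
   the contact amplitude [s] is below [e]. *)
have ulte : e^-1 < Psi z / u z.
  apply: lt_le_trans (zmax' _ Kxt).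
  by rewrite ltr_pdivlMr ?u0// mulrC ltr_pdivrMr// mulrC.
have Pz : 0 < Psi z.
  rewrite -(pmulr_lgt0 _ (_ : 0 < (u z)^-1)) ?invr_gt0//.
  by apply: lt_trans ulte; rewrite invr_gt0.
pose s := u z / Psi z.
have s0 : 0 < s by rewrite divr_gt0.
have se : s < e by rewrite -ltf_pV2 ?posrE// invfM invrK mulrC.
have sPz : s * Psi z = u z by rewrite /s divfK ?gt_eqF.
apply: (@no_contact_Psi s z) => //.
- split=> // w Aw; rewrite m0 !add0r sPz subrr subr_ge0.
  have [/(Psi_gt0 _ Aw)[Kw _]|Pw] := ltP 0 (Psi w).
    have := zmax' _ Kw; rewrite ler_pdivrMr ?u0// mulrAC ler_pdivlMr// => h.
    by rewrite /s mulrAC ler_pdivrMr// mulrC [u w * _]mulrC.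
  by apply: (@le_trans _ _ 0); [rewrite pmulr_rle0|rewrite -m0 u_ge].
(* A contact before [c1] would give e <= u(z) = s Psi(z) <= s < e. *)
- rewrite leNgt; apply/negP => zc.
  have : e <= u z.
    case: z Kz zc {zmax zmax' ulte Pz sPz s s0 se uz Az} => y r [/= wy].
    rewrite in_itv /= => /andP[ar _] rc; apply: bottom => //.
    by rewrite ar ltW.
  rewrite -sPz leNgt => /negP; apply; apply: le_lt_trans se.
  by rewrite ler_piMr ?(ltW s0)// Psi_le1.
- by rewrite sPz.
Qed.

End Barrier.

(** * Local propagation of positivity and existence of earlier zeros *)

Lemma nbhs_cylinder {R : realType} {n : nat} (Omega : set 'rV[R]_n) (T : R) z :
  open Omega -> cylinder Omega T z -> nbhs z (cylinder Omega T).
Proof.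
move=> oO; case: z => x t [/= Ox /andP[t0 tT]].
exists (Omega, [set s | 0 < s < T]) => //=; split=> /=.
  exact: open_nbhs_nbhs.
near=> s => /=; apply/andP; split; near: s; first exact: lt_nbhsr.
exact: lt_nbhsl.
Unshelve. all: by end_near. Qed.

(** Passes from closed Euclidean balls to the sup-norm balls in which neighbourhoods are
    expressed. *)
Lemma parab_ball {R : realType} {n : nat} (p x : 'rV[R]_n) (tau t rho d : R) :
  0 <= rho -> rho < d -> 0 <= parab p rho x -> `|tau - t| < d ->
  ball (p, tau) d (x, t).
Proof.
move=> rho0 rd w0 td; split => //=; split=> [|i j].
  exact: le_lt_trans rd.
by rewrite (ord1 i) /ball /= distrC (le_lt_trans _ rd)// parab_coord.
Qed.

Lemma eball_parab {R : realType} {n : nat} (p x : 'rV[R]_n) (rho : R) :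
  0 <= rho -> eball p rho x -> 0 < parab p rho x.
Proof.
move=> rho0; rewrite /eball /= => h; rewrite subr_gt0 -sqr_enorm.
by rewrite ltr_sqr ?nnegrE// sqrtr_ge0.
Qed.

Lemma parab_center {R : realType} {n : nat} (p : 'rV[R]_n) (rho : R) :
  parab p rho p = rho ^+ 2.
Proof.
rewrite /parab subrr /sqnorm big1 ?subr0// => i _.
by rewrite mxE expr0n.
Qed.

Section Supersolution.
Context {R : realType} {n : nat} (Omega : set 'rV[R]_n) (T : R).
Variables (H : 'rV[R]_n -> 'M[R]_n -> R) (k1 k m : R) (u : 'rV[R]_n * R -> R).
Hypotheses (openO : open Omega) (kE : k = k1 + 1)
  (hA : conditionA H) (hB : conditionB H k1) (hC : conditionC H)
  (super : viscosity_supersolution H k (cylinder Omega T) u)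
  (u_ge : forall z, cylinder Omega T z -> m <= u z).

Let k10 : 0 <= k1. Proof. by case: hB. Qed.

Lemma positivity_propagates (p : 'rV[R]_n) (tau : R) :
  0 < m -> lsc_on (cylinder Omega T) u ->
  cylinder Omega T (p, tau) -> m < u (p, tau) ->
  exists rho : R,
    [/\ 0 < rho, eball p rho `<=` Omega &
        forall x t, eball p rho x -> tau <= t < T -> m < u (x, t)].
Proof.
move=> m0 lsc Apt mu.
(* [barrier_pos] requires e <= m; half of the gap u(p, tau) - m leaves u > m + e on a whole
   neighbourhood by lower semicontinuity. *)
pose e := Num.min m ((u (p, tau) - m) / 2).
have e0 : 0 < e by rewrite lt_min m0 divr_gt0 ?subr_gt0.
have em : e <= m by rewrite ge_min lexx.
have eu : m + e < u (p, tau).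
  have : e <= (u (p, tau) - m) / 2 by rewrite ge_min lexx orbT.
  by move: mu; lra.
have : \forall z \near (p, tau), cylinder Omega T z /\ m + e < u z.
  near=> z; have Az : cylinder Omega T z by near: z; exact: nbhs_cylinder.
  split=> //; move: Az; near: z; exact: lsc_on_near.
move=> /nbhs_ballP[d /= d0 dA].
have [nu Hnu] := H_bump_ge _ _ hA hB hC.
pose rho := Num.min 1 (d / 2).
have rho0 : 0 < rho by rewrite lt_min ltr01 divr_gt0.
have rho01 : 0 < rho <= 1 by rewrite rho0 ge_min lexx.
have rd : rho < d by rewrite gt_min ltr_pdivrMr// ltr_pMr// ltr1n orbT.
have [C C0 HC] := Hnu _ rho01.
have inball y s : 0 <= parab p rho y -> tau - d / 2 <= s <= tau ->
    cylinder Omega T (y, s) /\ m + e < u (y, s).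
  move=> wy /andP[s1 s2]; apply: dA; apply: (@parab_ball _ _ _ _ _ _ rho) => //.
    exact: ltW.
  by rewrite ger0_norm ?subr_ge0//; lra.
have subO : [set x | 0 <= parab p rho x] `<=` Omega.
  move=> y wy; have [|[]//] := inball y tau wy.
  by rewrite lexx andbT gerBl ltW// divr_gt0.
have a0 : 0 < tau - d / 2.
  have [||[_ /andP[]]] := inball p (tau - d / 2) => //.
    by rewrite parab_center sqr_ge0.
  by rewrite lexx gerBl ltW// divr_gt0.
exists rho; split=> // [x /(eball_parab _ _ _ (ltW rho0))/ltW|];
  first exact: subO.
move=> x t /(eball_parab _ _ _ (ltW rho0)) wx /andP[taut tT].
(* Each t has its own barrier with c1 = tau, c2 = t and b midway between t and T, while the radius
   [rho] stays the same for all t. *)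
have := @barrier_pos _ _ Omega T H k1 k C nu u m p rho (tau - d / 2) tau t
  ((t + T) / 2) kE k10 C0 (HC p) super u_ge rho01 a0 _ _ _ subO e x t _ lsc _
  (ltW wx).
have d20 : 0 < d / 2 by rewrite divr_gt0.
move=> bar; apply: lt_le_trans (bar _ _ _ _ _ _).
- rewrite ltrDl mulr_gt0 ?e0// mulr_gt0 ?bump_gt0 ?expR_gt0//.
- by rewrite gtrBl.
- lra.
- lra.
- by rewrite e0.
- by move=> y s wy sI; have [_ /ltW] := inball _ _ wy sI.
- by rewrite taut lexx.
Unshelve. all: by end_near. Qed.

Lemma earlier_zero_near (p : 'rV[R]_n) (tau d : R) :
  m = 0 -> {within cylinder Omega T, continuous u} ->
  cylinder Omega T (p, tau) -> u (p, tau) = 0 -> 0 < d ->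
  exists z, [/\ ball (p, tau) d z, cylinder Omega T z, z.2 < tau & u z = 0].
Proof.
move=> m0 uC Apt u0 d0; apply: contrapT => nozero.
have := nbhs_cylinder _ _ _ openO Apt.
move=> /nbhs_ballP[d' /= d'0 d'A].
have [nu Hnu] := H_bump_ge _ _ hA hB hC.
pose r := Num.min d d'.
have r0 : 0 < r by rewrite lt_min d0.
have rd : r <= d by rewrite ge_min lexx.
have rd' : r <= d' by rewrite ge_min lexx orbT.
pose rho := Num.min 1 (r / 2).
have rho0 : 0 < rho by rewrite lt_min ltr01 divr_gt0.
have rho01 : 0 < rho <= 1 by rewrite rho0 ge_min lexx.
have rhor : rho < r by rewrite gt_min ltr_pdivrMr// ltr_pMr// ltr1n orbT.
have [C C0 HC] := Hnu _ rho01.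
have inball y s : 0 <= parab p rho y -> tau - r / 2 <= s <= tau ->
    ball (p, tau) r (y, s).
  move=> wy /andP[s1 s2]; apply: (@parab_ball _ _ _ _ _ _ rho) => //.
    exact: ltW.
  by rewrite ger0_norm ?subr_ge0//; lra.
have inA y s : 0 <= parab p rho y -> tau - r / 2 <= s <= tau ->
    cylinder Omega T (y, s).
  by move=> wy sI; apply: d'A; apply: le_ball rd' _ _; exact: inball.
have upos y s : 0 <= parab p rho y -> tau - r / 2 <= s < tau -> 0 < u (y, s).
  move=> wy /andP[s1 s2]; have sI : tau - r / 2 <= s <= tau by rewrite s1 ltW.
  have Ays := inA _ _ wy sI.
  rewrite lt_neqAle -[X in _ && (X <= _)]m0 u_ge// andbT eq_sym.
  apply/eqP => us0; apply: nozero; exists (y, s); split=> //.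
  by apply: le_ball rd _ _; exact: inball.
have wp : 0 <= parab p rho p by rewrite parab_center sqr_ge0.
have r20 : 0 < r / 2 by rewrite divr_gt0.
have subO : [set x | 0 <= parab p rho x] `<=` Omega.
  by move=> y wy; have [|//] := inA y tau wy; rewrite lexx andbT gerBl ltW.
have a0 : 0 < tau - r / 2.
  by have [|_ /andP[]//] := inA p (tau - r / 2) wp; rewrite lexx gerBl ltW.
have tauT : tau < T by case: Apt => _ /andP[].
(* This slab keeps the distance r/4 from time tau, so u > 0 on a compact set and its minimum there
   is a positive amplitude for the barrier. *)
pose K := [set x | 0 <= parab p rho x] `*`
  `[tau - r / 2, tau - r / 4]%classic.
have KA : K `<=` cylinder Omega T.
  case=> y s [/= wy]; rewrite in_itv /= => /andP[s1 s2]; apply: inA => //.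
  by rewrite s1; lra.
have Kp : K (p, tau - r / 2).
  by split=> //=; rewrite in_itv /= lexx /=; lra.
have [z Kz zmin] : exists2 z, z \in K & forall w, w \in K -> u z <= u w.
  apply: compact_EVT_min; first by exists (p, tau - r / 2).
    by apply: compact_setX;
      [exact: compact_parab_ge0 (ltW rho0)|exact: segment_compact].
  exact: continuous_subspaceW KA uC.
have e0 : 0 < u z.
  move: Kz; rewrite inE; case: (z) => y s [/= wy].
  by rewrite in_itv /= => /andP[s1 s2]; apply: upos => //; rewrite s1; lra.
(* The exponential is evaluated at tau, its least value for times up to tau, which makes the bound
   independent of c. *)
pose kappa := u z * (bump p rho nu p * expR (- (C + 1) * tau)).
have kappa0 : 0 < kappa.
  rewrite mulr_gt0 ?e0// mulr_gt0 ?expR_gt0// bump_gt0 parab_center.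
  exact: exprn_gt0.
have bar c : tau - r / 4 <= c < tau -> kappa <= u (p, c).
  move=> /andP[c1 c2].
  apply: (@le_trans _ _ (u z * (bump p rho nu p * expR (- (C + 1) * c)))).
    rewrite ler_pM2l// ler_pM2l ?bump_gt0 ?parab_center ?exprn_gt0//.
    by rewrite ler_expR !mulNr lerN2 ler_wpM2l ?addr_ge0// ltW.
  (* The choice b = (c + tau)/2 keeps the barrier within times before tau, where [u] is known to be
     positive. *)
  apply: (@barrier_zero _ _ Omega T H k1 k C nu u m p rho (tau - r / 2)
    (tau - r / 4) c ((c + tau) / 2) kE k10 C0 (HC p) super u_ge rho01 a0
    _ _ _ subO (u z) p c e0 m0 uC _ _ wp).
  - lra.
  - lra.
  - lra.
  - case=> y s [/= wy]; rewrite in_itv /= => /andP[s1 s2]; apply: upos => //.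
    by rewrite s1; lra.
  - move=> y s wy sI; apply: zmin; rewrite inE; split => //=.
  - by rewrite c1 lexx.
have : \forall w \near (p, tau), cylinder Omega T w -> u w < kappa.
  have := uC (p, tau) => /cvgrPdist_lt/(_ _ kappa0) near0.
  have VA : within (cylinder Omega T) (nbhs (p, tau)) [set w | u w < kappa].
    rewrite (nbhs_subspace_in Apt); apply: filterS near0 => w.
    by rewrite /from_subspace u0 sub0r normrN /=;
      exact: le_lt_trans (ler_norm _).
  exact: VA.
move=> /nbhs_ballP[d2 /= d20 d2A].
(* The time tau - s must lie both in the range of [bar] and in the neighbourhood where u < kappa. *)
pose s := Num.min (r / 4) (d2 / 2).
have s0 : 0 < s by rewrite lt_min !divr_gt0.
have sr : s <= r / 4 by rewrite ge_min lexx.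
have sd : s <= d2 / 2 by rewrite ge_min lexx orbT.
have pb : ball (p, tau) d2 (p, tau - s).
  split=> /=; first exact: ballxx.
  by rewrite /ball /= opprB addrC subrK gtr0_norm//; lra.
have : kappa <= u (p, tau - s) by apply: bar; lra.
rewrite leNgt d2A//; apply: inA => //; lra.
Qed.

End Supersolution.

(** * From the local statements to (a) and (b) *)

Theorem theorem1p2 (R : realType) (n : nat) (hn : (2 <= n)%N)
    (Omega : set 'rV[R]_n) (hOmega : domain Omega)
    (hbounded : bounded_set Omega)
    (T : R) (hT : 0 < T)
    (H : 'rV[R]_n -> 'M[R]_n -> R) (k1 k : R) (hk : k = k1 + 1)
    (hA : conditionA H) (hB : conditionB H k1) (hC : conditionC H)
    (hk1 : 1 < k)
    (u : 'rV[R]_n * R -> R)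
    (u_ge0 : forall z, cylinder Omega T z -> 0 <= u z)
    (u_lsc : lsc_on (cylinder Omega T) u)
    (u_super : viscosity_supersolution H k (cylinder Omega T) u)
    (m : R) (hm : m = inf [set u z | z in cylinder Omega T]) :
  (0 < m ->
    (forall (p : 'rV[R]_n) (tau : R), cylinder Omega T (p, tau) ->
       m < u (p, tau) ->
       exists rho : R,
         [/\ 0 < rho, eball p rho `<=` Omega &
             forall x t, eball p rho x -> tau <= t < T -> m < u (x, t)]) /\
    (forall (p : 'rV[R]_n) (tau : R), cylinder Omega T (p, tau) ->
       u (p, tau) = m ->
       forall s : R, 0 < s < tau -> u (p, s) = m)) /\
  (m = 0 -> {within cylinder Omega T, continuous u} ->
    forall (p : 'rV[R]_n) (tau : R), cylinder Omega T (p, tau) ->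
      u (p, tau) = 0 ->
      exists z : nat -> 'rV[R]_n * R,
        (forall l, [/\ cylinder Omega T (z l), (z l).2 < tau & u (z l) = 0]) /\
        z l @[l --> \oo] --> (p, tau)).
Proof.
have [_ openO _] := hOmega.
have u_ge z : cylinder Omega T z -> m <= u z.
  (* The real [inf] is a lower bound only for a set bounded below, here by 0. *)
  move=> Az; rewrite hm; apply: ge_inf; last by exists z.
  by exists 0 => _ [w Aw <-]; exact: u_ge0.
split=> [m0|m0 uC p tau Apt u0].
  have a p tau := @positivity_propagates _ _ _ _ _ _ _ _ _ openO hk hA hB hC
    u_super u_ge p tau m0 u_lsc.
  split=> // p tau Apt um s /andP[s0 stau].
  have [Op /andP[_ /= tauT]] := Apt.
  have Aps : cylinder Omega T (p, s).
    by split=> //=; rewrite s0 (lt_trans stau).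
  apply/eqP; rewrite eq_le u_ge// andbT leNgt; apply/negP => mu.
  (* If u(p, s) > m, then positivity propagates along the axis from s to tau and contradicts u(p,
     tau) = m. *)
  have [rho [rho0 _ h]] := a _ _ Aps mu.
  have := h p tau; rewrite um ltxx => /(_ _ _)/wrap[] //.
    by rewrite /eball /= /enorm subrr big1 ?sqrtr0// => i _; rewrite mxE expr0n.
  by rewrite (ltW stau).
(* Earlier zeros at distance less than 1/(l+1) from (p, tau) are selected by choice; the shift keeps
   the radius positive at l = 0. *)
have zero l : exists z, [/\ ball (p, tau) (l.+1%:R^-1) z,
    cylinder Omega T z, z.2 < tau & u z = 0].
  exact: (@earlier_zero_near _ _ _ _ _ _ _ _ _ openO hk hA hB hC u_super u_ge).
have [z hz] := choice zero.
exists z; split=> [l|]; first by have [_] := hz l.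
apply/cvg_ballP => e e0; near=> l.
have [zl _ _ _] := hz l; apply: le_ball zl.
near: l; have := @near_infty_natSinv_lt R (PosNum e0).
by apply: filterS => l /ltW.
Unshelve. all: by end_near. Qed.
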